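(* Let $\mathcal{B}=\{e_k\}_{k=1}^\infty$ be a seminormalized quasi-greedy basis of a real Banach space $\mathbb{B}$, and let $K$ be the quasi-greedy constant of $\mathcal{B}$. Then there is a constant $C>0$, independent of $N$ and $x$, such that for all $N=1,2,3,\dots$, all $x\in\mathbb{B}$ and every choice of greedy ordering $\pi$ of $x$, $$\|x-G_N(x)\|_{\mathbb{B}} \le C\, 8K^5\Big(\sum_{k=1}^N \mu(k)\frac{1}{k}\Big)\sigma_N(x).$$
   Context: $\mathcal B=\{e_k\}$ is a (Schauder) basis of $\mathbb B$ that is seminormalized, i.e. $0<\inf_k\|e_k\|\le\sup_k\|e_k\|<\infty$; each $x\in\mathbb B$ has a unique expansion $x=\sum_k a_k(x)e_k$. $\Sigma_N$ is the set of $y\in\mathbb B$ with at most $N$ nonzero coefficients, and $\sigma_N(x)=\inf_{y\in\Sigma_N}\|x-y\|_{\mathbb B}$. For $x\in\mathbb B$, a greedy ordering is a bijection $\pi$ of $\mathbb N$ with $|a_{\pi(k)}(x)|\ge|a_{\pi(k+1)}(x)|$ for all $k$, and $G_N(x)=\sum_{k=1}^N a_{\pi(k)}(x)e_{\pi(k)}$. The basis is quasi-greedy if $G_N(x)\to x$ for all $x$; its quasi-greedy constant $K$ is the least constant with $\|G_N(x)\|\le K\|x\|$ and $\|x-G_N(x)\|\le K\|x\|$ for all $x$, $N$ (and all greedy orderings). Democracy functions: $h_r(N)=\sup_{|\Gamma|=N}\|\sum_{k\in\Gamma}e_k\|$, $h_l(N)=\inf_{|\Gamma|=N}\|\sum_{k\in\Gamma}e_k\|$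 (over subsets $\Gamma\subset\mathbb N$ of cardinality $N$), and $\mu(N)=\sup_{1\le k\le N} h_r(k)/h_l(k)$. *)

(* Defs.v *)
From HB Require Import structures.
From mathcomp Require Import all_boot all_order all_algebra.
From mathcomp Require Import finmap.
From mathcomp Require Import all_classical all_reals all_analysis.
Set Implicit Arguments. Unset Strict Implicit. Unset Printing Implicit Defensive.
Import Order.TTheory GRing.Theory Num.Theory.
Import numFieldNormedType.Exports.
Local Open Scope classical_set_scope.
Local Open Scope ring_scope.
Local Open Scope fset_scope.

Definition is_schauder_basis {R : realType} {V : normedModType R}
  (e : nat -> V) (a : nat -> V -> R) : Prop :=
  (forall x : V, (fun n => \sum_(k < n) a k x *: e k) @ \oo --> x) /\
  (forall (x : V) (c : nat -> R),
     (fun n => \sum_(k < n) c k *: e k) @ \oo --> x -> forall k, c k = a k x).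

Definition seminormalized {R : realType} {V : normedModType R} (e : nat -> V) : Prop :=
  exists m M : R, 0 < m /\ forall k, m <= `|e k| <= M.

Definition greedy_ordering {R : realType} {V : normedModType R}
  (a : nat -> V -> R) (x : V) (pi : nat -> nat) : Prop :=
  bijective pi /\ forall k, `|a (pi k.+1) x| <= `|a (pi k) x|.

(* G_N(x) = sum_{k=1}^N a_{pi(k)}(x) e_{pi(k)} (indices shifted to start at 0) *)
Definition greedy_approx {R : realType} {V : normedModType R}
  (e : nat -> V) (a : nat -> V -> R) (pi : nat -> nat) (N : nat) (x : V) : V :=
  \sum_(k < N) a (pi k) x *: e (pi k).

Definition quasi_greedy {R : realType} {V : normedModType R}
  (e : nat -> V) (a : nat -> V -> R) : Prop :=
  forall x pi, greedy_ordering a x pi ->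
    (fun N => greedy_approx e a pi N x) @ \oo --> x.

Definition qg_bound {R : realType} {V : normedModType R}
  (e : nat -> V) (a : nat -> V -> R) (K : R) : Prop :=
  forall x pi N, greedy_ordering a x pi ->
    `|greedy_approx e a pi N x| <= K * `|x| /\
    `|x - greedy_approx e a pi N x| <= K * `|x|.

Definition is_qg_constant {R : realType} {V : normedModType R}
  (e : nat -> V) (a : nat -> V -> R) (K : R) : Prop :=
  qg_bound e a K /\ forall K', qg_bound e a K' -> K <= K'.

Definition SigmaN {R : realType} {V : normedModType R}
  (a : nat -> V -> R) (N : nat) : set V :=
  [set y | exists G : {fset nat}, (#|` G| <= N)%N /\ forall k, k \notin G -> a k y = 0].

Definition sigmaN {R : realType} {V : normedModType R}
  (a : nat -> V -> R) (N : nat) (x : V) : R :=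
  inf [set r | exists y, SigmaN a N y /\ r = `|x - y|].

Definition h_r {R : realType} {V : normedModType R} (e : nat -> V) (N : nat) : R :=
  sup [set r | exists G : {fset nat}, #|` G| = N /\ r = `|\sum_(k <- G) e k|].

Definition h_l {R : realType} {V : normedModType R} (e : nat -> V) (N : nat) : R :=
  inf [set r | exists G : {fset nat}, #|` G| = N /\ r = `|\sum_(k <- G) e k|].

(* mu(N) = max_{1<=k<=N} h_r(k)/h_l(k) (these ratios are >= 1, so 0 is a neutral start) *)
Definition mu {R : realType} {V : normedModType R} (e : nat -> V) (N : nat) : R :=
  \big[Num.max/0]_(1 <= k < N.+1) (h_r e k / h_l e k).

(* Main.v *)
Require Import Defs.
From HB Require Import structures.
From mathcomp Require Import all_boot all_order all_algebra.
From mathcomp Require Import finmap.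
From mathcomp Require Import all_classical all_reals all_analysis.
From mathcomp Require Import ring lra.
Set Implicit Arguments. Unset Strict Implicit. Unset Printing Implicit Defensive.
Import Order.TTheory GRing.Theory Num.Theory.
Import numFieldNormedType.Exports.
Local Open Scope ring_scope.

(** Let z = x - y with y supported on a set G of at most N indices, and let
Gamma be the first N indices of the greedy ordering. Then
  x - G_N x = z - P_Gamma z - P_(G \ Gamma) z + P_(G \ Gamma) x,
and the coefficients of x on G \ Gamma are dominated by those of z = x on
Gamma \ G, which has at least as many elements. Hence all three projections
have the form sum_(k in A) w_k e_k, with |A| <= N and with the decreasing
rearrangement of w below that of z. Abel summation together with
h_r j <= sum_(i <= j) h_r i / i gives
  |sum_A w_k e_k| <= 2 K sum_j w*_j h_r j / j,
and w*_j <= z*_j <= 4 K^2 |z| / h_l j, by Abel summation on the greedy sums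
of z and unconditionality for constant coefficients.

A vector of infinite support with a zero coefficient has no greedy ordering in
the sense of a bijection, so the quasi-greedy bound is only applied to finitely
supported vectors; the bound on z*_j passes to the limit along the partial sums. *)

(** * Decreasing order of moduli and Abel summation *)

Definition decreasing_on {R : realType} (c : nat -> R) : rel nat :=
  fun i j => `|c j| <= `|c i|.

Lemma decreasing_on_trans {R : realType} (c : nat -> R) :
  transitive (decreasing_on c).
Proof. by move=> j i k; rewrite /decreasing_on => h1 h2; apply: le_trans h1. Qed.

Lemma decreasing_on_total {R : realType} (c : nat -> R) :
  total (decreasing_on c).
Proof. by move=> i j; apply: le_total. Qed.

Lemma abel_sum {R : realType} {V : lmodType R} (b : nat -> R) (v : nat -> V) n :
  \sum_(i < n.+1) b i *: v i =
  \sum_(i < n) (b i - b i.+1) *: (\sum_(j < i.+1) v j) +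
  b n *: (\sum_(j < n.+1) v j).
Proof.
elim: n => [|n IH]; first by rewrite !big_ord_recr !big_ord0 /= !add0r.
rewrite big_ord_recr IH /= [in RHS]big_ord_recr /= [in RHS](big_ord_recr n.+1) /=.
by rewrite scalerDr scalerBl !addrA subrK.
Qed.

(** After Abel summation both sides carry the same nonnegative weights, so it is enough to compare
    the partial sums. *)
Lemma abel_norm_decr {R : realType} {V : normedModType R}
    (b f : nat -> R) (v : nat -> V) n :
  (forall i, (i < n)%N -> 0 <= b i) ->
  (forall i, (i.+1 < n)%N -> b i.+1 <= b i) ->
  (forall j, (j <= n)%N -> `|\sum_(i < j) v i| <= \sum_(i < j) f i) ->
  `|\sum_(i < n) b i *: v i| <= \sum_(i < n) b i * f i.
Proof.
case: n => [|n] b0 bd vf; first by rewrite !big_ord0 normr0.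
(* Viewed in [R^o], the right-hand sum is also a linear combination, so [abel_sum] applies to both
   sides. *)
have -> : \sum_(i < n.+1) b i * f i = \sum_(i < n.+1) b i *: (f i : R^o) by [].
rewrite !abel_sum; apply: le_trans (ler_normD _ _) _.
apply: lerD; last first.
  by rewrite normrZ ger0_norm ?b0//; apply: ler_wpM2l (vf _ _); rewrite ?b0.
apply: le_trans (ler_norm_sum _ _ _) _; apply: ler_sum => i _.
have bi : 0 <= b i - b i.+1 by rewrite subr_ge0 bd // ltnS.
by rewrite normrZ ger0_norm//; apply: ler_wpM2l => //; apply: vf; rewrite ltnS ltnW.
Qed.

(** The differences now telescope to [b n - b 0], so Abel summation yields at most
    [(2 * b n - b 0) * D]. *)
Lemma abel_norm_incr {R : realType} {V : normedModType R}
    (b : nat -> R) (v : nat -> V) n (D : R) :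
  (forall i, (i <= n)%N -> 0 <= b i) ->
  (forall i, (i < n)%N -> b i <= b i.+1) ->
  (forall j, (j <= n.+1)%N -> `|\sum_(i < j) v i| <= D) ->
  `|\sum_(i < n.+1) b i *: v i| <= 2 * b n * D.
Proof.
move=> b0 bi vD; rewrite abel_sum; apply: le_trans (ler_normD _ _) _.
have D0 : 0 <= D by apply: le_trans (vD 0%N _) => //.
have h1 : `|b n *: (\sum_(j < n.+1) v j)| <= b n * D.
  by rewrite normrZ ger0_norm ?b0//; apply: ler_wpM2l (vD _ _); rewrite ?b0.
suff h2 : `|\sum_(i < n) (b i - b i.+1) *: (\sum_(j < i.+1) v j)| <= (b n - b 0%N) * D.
  have := b0 0%N isT; nra.
apply: le_trans (ler_norm_sum _ _ _) _.
rewrite -(telescope_sumr b (leq0n n)) big_mkord mulr_suml.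
apply: ler_sum => i _; rewrite normrZ distrC ger0_norm ?subr_ge0 ?bi//.
by apply: ler_wpM2l (vD _ _); rewrite ?subr_ge0 ?bi // ltnS ltnW.
Qed.

Lemma sumr_const_size {V : nmodType} (x : V) (s : seq nat) :
  \sum_(k <- s) x = x *+ size s.
Proof. by rewrite big_const_seq count_predT iter_addr_0. Qed.

Lemma sum_nth_take {V : nmodType} (F : nat -> V) (s : seq nat) j :
  (j <= size s)%N -> \sum_(i < j) F (nth 0%N s i) = \sum_(k <- take j s) F k.
Proof.
move=> js; rewrite (big_nth 0%N) size_takel // big_mkord.
by apply: eq_bigr => i _; rewrite nth_take.
Qed.

Lemma sum_nth_seq {V : nmodType} (F : nat -> V) (s : seq nat) :
  \sum_(i < size s) F (nth 0%N s i) = \sum_(k <- s) F k.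
Proof. by rewrite sum_nth_take // take_size. Qed.

(** * Democracy functions *)

Section DemocracyFunctions.
Variables (R : realType) (V : normedModType R) (e : nat -> V).
Hypothesis e_sn : seminormalized e.

Lemma fset_of_uniq (s : seq nat) : uniq s ->
  exists G : {fset nat}, #|` G| = size s /\
    \sum_(k <- G) e k = \sum_(k <- s) e k.
Proof.
move=> us; exists [fset x in s]%fset; split; first by rewrite card_fseq undup_id.
apply: perm_big; apply: uniq_perm => [|//|i]; first exact: fset_uniq.
by rewrite inE.
Qed.

Lemma le_h_r (s : seq nat) : uniq s ->
  `|\sum_(k <- s) e k| <= h_r e (size s).
Proof.
move=> us; have [G [sG eG]] := fset_of_uniq us.
have [m [M [m0 eM]]] := e_sn.
apply: ub_le_sup; last by exists G; rewrite eG.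
exists (M *+ size s) => _ [G' [sG' ->]]; apply: le_trans (ler_norm_sum _ _ _) _.
rewrite -sG' -sumr_const_size; apply: ler_sum => k _; by case/andP: (eM k).
Qed.

Lemma h_r_le n (B : R) :
  (forall s, uniq s -> size s = n -> `|\sum_(k <- s) e k| <= B) -> h_r e n <= B.
Proof.
move=> H; apply: ge_sup; last by move=> _ [G [sG ->]]; exact: H (fset_uniq G) sG.
have [G [sG eG]] := fset_of_uniq (iota_uniq 0 n).
by exists `|\sum_(k <- G) e k|, G; rewrite sG size_iota.
Qed.

Lemma h_l_le (s : seq nat) : uniq s ->
  h_l e (size s) <= `|\sum_(k <- s) e k|.
Proof.
move=> us; have [G [sG eG]] := fset_of_uniq us.
apply: ge_inf; last by exists G; rewrite eG.
by exists 0 => _ [G' [sG' ->]].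
Qed.

Lemma le_h_l n (B : R) :
  (forall s, uniq s -> size s = n -> B <= `|\sum_(k <- s) e k|) -> B <= h_l e n.
Proof.
move=> H; apply: lb_le_inf; last by move=> _ [G [sG ->]]; exact: H (fset_uniq G) sG.
have [G [sG eG]] := fset_of_uniq (iota_uniq 0 n).
by exists `|\sum_(k <- G) e k|, G; rewrite sG size_iota.
Qed.

Lemma h_r_ge0 n : 0 <= h_r e n.
Proof. by have := le_h_r (iota_uniq 0 n); rewrite size_iota; apply: le_trans. Qed.

(* Averaging over the [n]-element subsets of a set with [n.+1] elements. *)
Lemma h_r_averaging n : n%:R * h_r e n.+1 <= n.+1%:R * h_r e n.
Proof.
case: n => [|n]; first by rewrite mul0r mul1r h_r_ge0.
rewrite -ler_pdivlMl ?ltr0n//; apply: h_r_le => s us ss.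
rewrite ler_pdivlMl ?ltr0n//.
pose S := \sum_(k <- s) e k.
have -> : n.+1%:R * `|S| = `|\sum_(k <- s) (S - e k)|.
  rewrite big_split /= sumrN sumr_const_size ss.
  by rewrite mulrSr addrK normrMn mulr_natl.
apply: le_trans (ler_norm_sum _ _ _) _.
rewrite mulr_natl -ss -sumr_const_size big_seq [leRHS]big_seq; apply: ler_sum => k ks.
rewrite /S (big_rem k ks) /= addrAC subrr add0r -[n.+1]/(n.+2.-1) -ss -(size_rem ks).
by apply: le_h_r; apply: rem_uniq.
Qed.

(** Averaging bounds the increment of [h_r] from [n] to [n.+1] by [h_r e n.+1 / n.+1], and the
    increments telescope from [h_r e 0 <= 0]. *)
Lemma h_r_le_sum n : h_r e n <= \sum_(i < n) h_r e i.+1 / i.+1%:R.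
Proof.
elim: n => [|n IH].
  by rewrite big_ord0; apply: h_r_le => s _ /size0nil ->; rewrite big_nil normr0.
rewrite big_ord_recr /=.
apply: le_trans (lerD IH (lexx _)); rewrite -lerBlDr.
have n1 : n.+1%:R != 0 :> R by rewrite pnatr_eq0.
rewrite -[X in X - _](mulfK n1) -mulrBl ler_pdivrMr ?ltr0n// -natr1 mulrDr mulr1.
by rewrite addrK mulrC natr1 [leRHS]mulrC h_r_averaging.
Qed.

Lemma ratio_le_mu n : (0 < n)%N -> h_r e n / h_l e n <= mu e n.
Proof.
move=> n0; rewrite /mu; apply: (Order.TotalTheory.bigmax_sup_seq _ n) => //.
by rewrite mem_index_iota n0 /= ltnSn.
Qed.

End DemocracyFunctions.

(** * Extension of a finite list to a bijection of the indices *)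

Lemma seq_nat_bounded (s : seq nat) : exists n, forall k, k \in s -> (k < n)%N.
Proof.
exists (\max_(k <- s) k.+1)%N => k ks.
exact: (@leq_bigmax_seq _ s xpredT (fun k => k.+1) k ks).
Qed.

(** Greedy orderings are bijections of all indices, so a sorted finite support has to be completed
    to one. *)
Lemma prefix_bijection (s : seq nat) : uniq s ->
  exists pi : nat -> nat, [/\ bijective pi,
    forall k, (k < size s)%N -> pi k = nth 0%N s k &
    forall k, (size s <= k)%N -> pi k \notin s].
Proof.
move=> us; have [n sn] := seq_nat_bounded s.
(* [s'] enumerates the indices below [n], those of [s] first. *)
pose s' := s ++ [seq i <- iota 0 n | i \notin s].
have us' : uniq s'.
  rewrite cat_uniq us filter_uniq ?iota_uniq // andbT /=.
  by apply/hasPn => i; rewrite mem_filter => /andP[].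
have ms' i : (i \in s') = (i < n)%N.
  rewrite mem_cat mem_filter mem_iota add0n leq0n /=.
  by case: (boolP (i \in s)) => //= /sn ->.
have ss' : size s' = n.
  rewrite -(size_iota 0 n); apply: perm_size; apply: uniq_perm => //.
    exact: iota_uniq.
  by move=> i; rewrite ms' mem_iota.
(* The default value [k] makes the map the identity from [n] on. *)
exists (fun k => nth k s' k); split.
- exists (fun i => if (i < n)%N then index i s' else i) => k.
  + case: (ltnP k n) => kn.
      by rewrite -ms' mem_nth ?ss' // index_uniq // ss'.
    by rewrite nth_default ?ss' // ltnNge kn.
  + case: (ltnP k n) => kn; last by rewrite nth_default ?ss'.
    by rewrite (set_nth_default k) ?nth_index ?index_mem ?ms'.
- by move=> k ks; rewrite nth_cat ks (set_nth_default 0%N).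
- move=> k sk; case: (ltnP k n) => kn; last first.
    by rewrite nth_default ?ss' //; apply: contraL kn => /sn; rewrite -ltnNge.
  rewrite nth_cat ltnNge sk /=.
  have : nth k [seq i <- iota 0 n | i \notin s] (k - size s) \in
      [seq i <- iota 0 n | i \notin s].
    apply: mem_nth; move: ss'; rewrite size_cat => ss'.
    by rewrite ltn_subLR // ss'.
  by rewrite mem_filter => /andP[].
Qed.

(** * Coefficients of finitely supported vectors *)

Section QuasiGreedyBasis.
Local Open Scope classical_set_scope.
Local Open Scope ring_scope.
Variables (R : realType) (V : normedModType R).
Variables (e : nat -> V) (a : nat -> V -> R) (K : R).
Hypothesis basis_e : is_schauder_basis e a.
Hypothesis e_sn : seminormalized e.
Hypothesis qgK : qg_bound e a K.

Lemma cvg_finite_support (s : seq nat) (c : nat -> R) : uniq s ->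
  (forall k, k \notin s -> c k = 0) ->
  (fun n => \sum_(k < n) c k *: e k) @ \oo --> \sum_(k <- s) c k *: e k.
Proof.
move=> us c0; apply: cvg_near_cst; have [n0 sn] := seq_nat_bounded s.
near=> n; have nn : (n0 <= n)%N by near: n; exact: nbhs_infty_ge.
rewrite -(big_mkord xpredT (fun k => c k *: e k)) (bigID (mem s)) /=.
rewrite [X in _ + X]big1 => [|k /c0 ->]; last by rewrite scale0r.
rewrite addr0 -big_filter; apply: perm_big; apply: uniq_perm => //.
  by rewrite filter_uniq // iota_uniq.
move=> k; rewrite mem_filter mem_index_iota /=.
by case: (boolP (k \in s)) => //= /sn /leq_trans; apply.
Unshelve. all: by end_near. Qed.

Lemma coef_sum (s : seq nat) (c : nat -> R) i : uniq s ->
  a i (\sum_(k <- s) c k *: e k) = if i \in s then c i else 0.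
Proof.
move=> us; pose c' k := if k \in s then c k else 0.
have -> : \sum_(k <- s) c k *: e k = \sum_(k <- s) c' k *: e k.
  by rewrite big_seq [RHS]big_seq; apply: eq_bigr => k ks; rewrite /c' ks.
apply/esym/(basis_e.2 _ c'); apply: cvg_finite_support => // k ks.
by rewrite /c' (negbTE ks).
Qed.

Lemma finite_support_sum (s : seq nat) (y : V) : uniq s ->
  (forall k, k \notin s -> a k y = 0) -> y = \sum_(k <- s) a k y *: e k.
Proof.
move=> us y0; apply: (norm_cvg_unique (basis_e.1 y)).
exact: cvg_finite_support.
Qed.

Lemma coefB k (x y : V) : a k (x - y) = a k x - a k y.
Proof.
apply/esym; apply: (basis_e.2 _ (fun k => a k x - a k y)).
have -> : (fun n => \sum_(k < n) (a k x - a k y) *: e k) =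
    (fun n => \sum_(k < n) a k x *: e k - \sum_(k < n) a k y *: e k).
  apply/funext => n; rewrite -sumrB; apply: eq_bigr => i _.
  by rewrite scalerBl.
by apply: cvgB; apply: basis_e.1.
Qed.

(** * Greedy sums of finitely supported vectors *)

(** Completing [s ++ t] to a bijection gives a greedy ordering of the whole sum, since coefficients
    vanish past the list. The sum over [s] is then the greedy sum of length [size s]. *)
Lemma greedy_prefix (s t : seq nat) (c : nat -> R) :
  uniq (s ++ t) -> sorted (decreasing_on c) (s ++ t) ->
  `|\sum_(k <- s) c k *: e k| <= K * `|\sum_(k <- s ++ t) c k *: e k|.
Proof.
move=> us st; have [pi [bij_pi pi_lt pi_ge]] := prefix_bijection us.
set x := \sum_(k <- s ++ t) _.
have gx : greedy_ordering a x pi.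
  split=> // k; rewrite !coef_sum //.
  case: (ltnP k.+1 (size (s ++ t))) => ks; last first.
    by rewrite (negbTE (pi_ge _ ks)) normr0.
  have ks' := ltnW ks; rewrite !pi_lt // !mem_nth //.
  by have /(sortedP 0%N) := st; apply.
have [+ _] := qgK (size s) gx; congr (`| _ | <= _).
rewrite -sum_nth_seq; apply: eq_bigr => i _.
have ks : (i < size (s ++ t))%N by rewrite size_cat ltn_addr.
by rewrite coef_sum // pi_lt // mem_nth // nth_cat ltn_ord.
Qed.

(** The nonzero vector [e 0] is its own greedy sum of length 1. *)
Lemma qg_bound_ge1 : 1 <= K.
Proof.
have [m [M [m0 eM]]] := e_sn; have /andP[me _] := eM 0%N.
have := @greedy_prefix [:: 0%N] [::] (fun=> 1) isT isT.
rewrite cats0 big_seq1 scale1r; nra.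
Qed.

Lemma K_ge0 : 0 <= K. Proof. exact: le_trans qg_bound_ge1. Qed.

(** When all coefficients are 1, any index of the set may come first in a greedy ordering; this
    gives the lower bound [m / K]. *)
Lemma h_l_gt0 n : (0 < n)%N -> 0 < h_l e n.
Proof.
move=> n0; have [m [M [m0 eM]]] := e_sn.
have K0 : 0 < K by apply: lt_le_trans qg_bound_ge1.
apply: lt_le_trans (_ : m / K <= _); first exact: divr_gt0.
apply: le_h_l => -[|k s] us ss; first by rewrite -ss in n0.
rewrite ler_pdivrMr // mulrC; have /andP[me _] := eM k; apply: le_trans me _.
have := @greedy_prefix [:: k] s (fun=> 1) us.
rewrite big_seq1 scale1r; under eq_bigr do rewrite scale1r.
by apply; apply/(sortedP 0%N) => i _; apply: lexx.
Qed.

Lemma ratio_ge0 n : (0 < n)%N -> 0 <= h_r e n / h_l e n.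
Proof. by move=> n0; rewrite divr_ge0 ?h_r_ge0 // ltW // h_l_gt0. Qed.

Lemma mu_ge0 n : (0 < n)%N -> 0 <= mu e n.
Proof. by move=> n0; apply: le_trans (ratio_le_mu e n0); apply: ratio_ge0. Qed.

(** The term [k = 1] suffices. This later absorbs the summand [|z|] that comes without a factor
    [mu]. *)
Lemma sum_mu_ge1 N : (0 < N)%N -> 1 <= \sum_(1 <= k < N.+1) mu e k / k%:R.
Proof.
move=> N0; rewrite big_ltn // divr1.
apply: le_trans (_ : mu e 1 <= _); last first.
  rewrite lerDl big_seq; apply: sumr_ge0 => k.
  rewrite mem_index_iota => /andP[k1 _].
  by rewrite divr_ge0 // mu_ge0 // (leq_trans _ k1).
apply: le_trans (ratio_le_mu e (ltn0Sn 0)).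
rewrite ler_pdivlMr ?h_l_gt0 // mul1r.
by apply: le_trans (h_l_le e _) (le_h_r e_sn (s := [:: 0%N]) _).
Qed.

(** * Unconditionality for constant coefficients *)

(** All moduli equal 1, so every sub-sum is a greedy sum and costs a factor [K]. The sum with signs
    [b] is the difference of two sub-sums with signs [b'], over the indices where the signs agree
    and where they differ. *)
Lemma sign_change (s : seq nat) (b b' : pred nat) : uniq s ->
  `|\sum_(k <- s) (-1) ^+ b k *: e k| <=
    2 * K * `|\sum_(k <- s) (-1) ^+ b' k *: e k|.
Proof.
move=> us; pose p k := b k == b' k.
have half (q : pred nat) : `|\sum_(k <- s | q k) (-1) ^+ b' k *: e k| <=
    K * `|\sum_(k <- s) (-1) ^+ b' k *: e k|.
  have pq := permEl (perm_filterC q s).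
  rewrite -big_filter -(perm_big _ pq) /=; apply: greedy_prefix.
    by rewrite (perm_uniq pq).
  by apply/(sortedP 0%N) => i _; rewrite /decreasing_on !normr_sign.
rewrite (bigID p) /=.
rewrite (eq_bigr (fun k => (-1) ^+ b' k *: e k)); last by move=> k /eqP ->.
rewrite [X in _ + X](eq_bigr (fun k => - ((-1) ^+ b' k *: e k))); last first.
  move=> k; rewrite /p -scaleNr; case: (b k) (b' k) => [] [] //= _.
  by rewrite expr0 expr1 opprK.
rewrite sumrN; apply: le_trans (ler_normB _ _) _.
by rewrite -mulrA mulr2n mulrDl !mul1r; apply: lerD; apply: half.
Qed.

(** The weights [|c k|^-1] increase along [s] and turn [c k] into its sign, while the partial sums
    of [c k *: e k] are greedy sums bounded by [K * |x|]. The last weight is at most [r^-1]. *)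
Lemma greedy_prefix_sign (s t : seq nat) (c : nat -> R) (r : R) : 0 < r ->
  uniq (s ++ t) -> sorted (decreasing_on c) (s ++ t) ->
  (forall k, k \in s -> r <= `|c k|) ->
  r * `|\sum_(k <- s) (-1) ^+ (c k < 0)%R *: e k| <=
    2 * K * `|\sum_(k <- s ++ t) c k *: e k|.
Proof.
move=> r0 us st rc; set x := \sum_(k <- s ++ t) _.
case ss : (size s) => [|n].
  rewrite (size0nil ss) big_nil normr0 mulr0.
  by rewrite !mulr_ge0 // K_ge0.
have ns : (n < size s)%N by rewrite ss.
have c0 i : (i < size s)%N -> 0 < `|c (nth 0%N s i)|.
  by move=> si; apply: lt_le_trans (rc _ (mem_nth _ si)).
have := @abel_norm_incr _ _ (fun i => `|c (nth 0%N s i)|^-1)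
  (fun i => c (nth 0%N s i) *: e (nth 0%N s i)) n (K * `|x|).
have -> : \sum_(i < n.+1) `|c (nth 0%N s i)|^-1 *:
    (c (nth 0%N s i) *: e (nth 0%N s i)) =
    \sum_(k <- s) (-1) ^+ (c k < 0)%R *: e k.
  rewrite -sum_nth_seq ss; apply: eq_bigr => i _; rewrite scalerA.
  have ci : 0 < `|c (nth 0%N s i)| by rewrite c0 // ss.
  by rewrite {2}[c _]numEsign mulrCA mulVf ?mulr1 // gt_eqF.
move=> H; apply: le_trans (_ : r * (2 * `|c (nth 0%N s n)|^-1 * (K * `|x|)) <= _).
  apply: ler_wpM2l (H _ _ _); first exact: ltW.
  - by move=> i _; rewrite invr_ge0.
  - move=> i ni; have si : (i.+1 < size s)%N by rewrite ss ltnS.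
    rewrite lef_pV2 ?posrE ?c0 // ?(ltn_trans _ si) //.
    have /(sortedP 0%N)/(_ i) := st.
    rewrite size_cat ltn_addr // !nth_cat si (ltn_trans _ si) //.
    by apply.
  - move=> j jn; have js : (j <= size s)%N by rewrite ss.
    rewrite (sum_nth_take (fun k => c k *: e k)) // /x.
    have sE : s ++ t = take j s ++ (drop j s ++ t) by rewrite catA cat_take_drop.
    by rewrite sE; apply: greedy_prefix; rewrite -sE.
have cn := c0 _ ns; have rn := rc _ (mem_nth 0%N ns).
have -> : r * (2 * `|c (nth 0%N s n)|^-1 * (K * `|x|)) =
  (r / `|c (nth 0%N s n)|) * (2 * K * `|x|) by field; rewrite gt_eqF.
apply: ler_piMl; first by rewrite !mulr_ge0 // K_ge0.
by rewrite ler_pdivrMr // mul1r.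
Qed.

(** * Bound on the decreasing rearrangement of the coefficients *)

(** The set [s] may be replaced by the [size s] largest entries of [L], which are also at least [r]
    and form a greedy prefix. *)
Lemma level_h_l_fin (L s : seq nat) (c : nat -> R) (r : R) : 0 <= r ->
  uniq L -> uniq s -> {subset s <= L} ->
  (forall k, k \in s -> r <= `|c k|) ->
  r * h_l e (size s) <= 4 * K ^+ 2 * `|\sum_(k <- L) c k *: e k|.
Proof.
rewrite le_eqVlt => /orP[/eqP <- *|r0 uL us sL rc].
  by rewrite mul0r !mulr_ge0 // K_ge0.
pose L' := sort (decreasing_on c) L.
have pL : perm_eq L' L by rewrite perm_sort.
have sizeL : (size s <= size L')%N by rewrite size_sort uniq_leq_size.
have sortL : sorted (decreasing_on c) L'.
  by apply: sort_sorted; apply: decreasing_on_total.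
have uL' : uniq L' by rewrite sort_uniq.
have big_top k : k \in take (size s) L' -> r <= `|c k|.
  move=> /(nthP 0%N)[i]; rewrite size_takel // => si <-; rewrite nth_take //.
  (* Were the entry at position [i] below [r], all of [s] would lie among the [i] entries before
     it. *)
  rewrite leNgt; apply/negP => ci.
  suff : (size s <= i)%N by rewrite leqNgt si.
  have iL := leq_trans si sizeL; rewrite -(size_takel (ltnW iL)).
  apply: uniq_leq_size => // m ms.
  have mL : m \in L' by rewrite (perm_mem pL) sL.
  rewrite in_take_leq ?(ltnW iL) // ltnNge; apply/negP => im.
  have := @sorted_leq_nth _ _ (@decreasing_on_trans _ c)
    (fun k => lexx `|c k|) 0%N _ sortL i (index m L').
  rewrite !inE iL index_mem mL nth_index // => /(_ isT isT im).
  by rewrite /decreasing_on leNgt (lt_le_trans ci (rc _ ms)).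
rewrite -(perm_big _ pL) /= -(cat_take_drop (size s) L').
(* Passing from constant signs, as in [h_l], to the signs of [c] costs one factor [2 * K];
   [greedy_prefix_sign] costs the other. *)
apply: le_trans (_ : r * (2 * K *
    `|\sum_(k <- take (size s) L') (-1) ^+ (c k < 0)%R *: e k|) <= _).
  rewrite ler_pM2l //; apply: le_trans (sign_change pred0 _ (take_uniq _ uL')).
  under eq_bigr do rewrite expr0 scale1r.
  by rewrite -{1}(size_takel sizeL); apply/h_l_le/take_uniq.
rewrite mulrCA (_ : 4 * K ^+ 2 = 2 * K * (2 * K)); last by ring.
rewrite -[leRHS]mulrA; apply: ler_wpM2l; first by rewrite mulr_ge0 // K_ge0.
by apply: greedy_prefix_sign => //; rewrite cat_take_drop.
Qed.

(** Having [j = size s] coefficients of modulus at least [r] means [r <= x*_j], so this bounds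
    [x*_j] without constructing the rearrangement. Partial sums of [x] long enough to cover [s]
    reduce it to the finite case. *)
Lemma level_h_l (x : V) (s : seq nat) (r : R) : 0 <= r -> uniq s ->
  (forall k, k \in s -> r <= `|a k x|) ->
  r * h_l e (size s) <= 4 * K ^+ 2 * `|x|.
Proof.
move=> r0 us rs; have [n0 sn] := seq_nat_bounded s.
have cx : (fun n : nat => 4 * K ^+ 2 * `|\sum_(k < n) a k x *: e k|) @ \oo -->
    4 * K ^+ 2 * `|x| by apply: cvgM (cvg_cst _) (cvg_norm (basis_e.1 x)).
apply: (@ler_cvg_to nat \oo _ R (fun=> r * h_l e (size s)) _ _ _ (cvg_cst _) cx).
near=> n; have nn : (n0 <= n)%N by near: n; exact: nbhs_infty_ge.
rewrite -(big_mkord xpredT (fun k => a k x *: e k)).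
apply: level_h_l_fin => //; first exact: iota_uniq.
by move=> k /sn kn; rewrite mem_index_iota (leq_trans kn).
Unshelve. all: by end_near. Qed.

(** * Sums over at most [N] indices with controlled rearrangement *)

(** Abel summation replaces the signed vectors by the increments [2 * K * h_r e j / j], and
    [|w*_j| <= D / h_l e j] then produces the ratios in [mu]. Position [j] of the list has rank
    [j.+1]. *)
Lemma weighted_sum_le (s : seq nat) (w : nat -> R) (D : R) N :
  uniq s -> sorted (decreasing_on w) s -> (size s <= N)%N -> 0 <= D ->
  (forall j, (j < size s)%N -> `|w (nth 0%N s j)| * h_l e j.+1 <= D) ->
  `|\sum_(k <- s) w k *: e k| <=
    2 * K * D * \sum_(1 <= k < N.+1) mu e k / k%:R.
Proof.
move=> us ss sN D0 wD.
have K2 : 0 <= 2 * K by rewrite mulr_ge0 // K_ge0.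
have -> : \sum_(k <- s) w k *: e k =
    \sum_(i < size s) `|w (nth 0%N s i)| *:
      ((-1) ^+ (w (nth 0%N s i) < 0)%R *: e (nth 0%N s i)).
  rewrite -sum_nth_seq; apply: eq_bigr => i _.
  by rewrite scalerA mulrC -numEsign.
apply: le_trans (_ : \sum_(i < size s)
    `|w (nth 0%N s i)| * (2 * K * (h_r e i.+1 / i.+1%:R)) <= _).
  apply: (@abel_norm_decr _ _ (fun i => `|w (nth 0%N s i)|)
    (fun i => 2 * K * (h_r e i.+1 / i.+1%:R))
    (fun i => (-1) ^+ (w (nth 0%N s i) < 0)%R *: e (nth 0%N s i))) => //.
    by move=> i si; have /(sortedP 0%N) := ss; apply.
  move=> j js; rewrite (sum_nth_take (fun k => (-1) ^+ (w k < 0)%R *: e k)) //.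
  rewrite -mulr_sumr; have ut := take_uniq j us.
  apply: le_trans (sign_change _ pred0 ut) _; apply: ler_wpM2l => //.
  under eq_bigr do rewrite expr0 scale1r.
  apply: le_trans (le_h_r e_sn ut) _; rewrite size_takel //.
  exact: h_r_le_sum.
rewrite big_add1 /= mulr_sumr.
(* Extending the range from [size s] to [N] only adds nonnegative terms. *)
apply: le_trans (_ : \sum_(0 <= i < size s)
    2 * K * D * (mu e i.+1 / i.+1%:R) <= _); last first.
  rewrite (big_cat_nat (leq0n _) sN) /= lerDl; apply: sumr_ge0 => i _.
  by rewrite !mulr_ge0 // ?K_ge0 ?mu_ge0 ?invr_ge0.
rewrite big_mkord; apply: ler_sum => i _.
have hl := h_l_gt0 (ltn0Sn i).
rewrite mulrCA -[leRHS]mulrA; apply: ler_wpM2l => //.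
rewrite !mulrA ler_wpM2r ?invr_ge0 //.
apply: le_trans (_ : D * (h_r e i.+1 / h_l e i.+1) <= _); last first.
  by apply: ler_wpM2l => //; apply: ratio_le_mu.
rewrite mulrA -mulrAC; apply: ler_wpM2r; first exact: h_r_ge0.
by rewrite ler_pdivlMr // wD.
Qed.

(** The last hypothesis expresses [w* <= z*] by counting: [z] has at least as many coefficients
    above each level [|w i|] as [w] has on [s]. The constant is [2 * K] times the [4 * K ^+ 2] of
    [level_h_l]. *)
Lemma rearrangement_sum_le (z : V) (s : seq nat) (w : nat -> R) N :
  uniq s -> (size s <= N)%N ->
  (forall t i, uniq t -> {subset t <= s} -> (forall k, k \in t -> `|w i| <= `|w k|) ->
    exists t', [/\ uniq t', size t' = size t &
                   forall k, k \in t' -> `|w i| <= `|a k z|]) ->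
  `|\sum_(k <- s) w k *: e k| <=
    8 * K ^+ 3 * `|z| * \sum_(1 <= k < N.+1) mu e k / k%:R.
Proof.
move=> us sN wz; pose s' := sort (decreasing_on w) s.
have ps : perm_eq s' s by rewrite perm_sort.
have ss : sorted (decreasing_on w) s'.
  by apply: sort_sorted; apply: decreasing_on_total.
have us' : uniq s' by rewrite sort_uniq.
rewrite -(perm_big _ ps) /=.
have -> : 8 * K ^+ 3 * `|z| = 2 * K * (4 * K ^+ 2 * `|z|) by ring.
apply: weighted_sum_le => //.
- by rewrite size_sort.
- by rewrite !mulr_ge0 // K_ge0.
move=> j js.
(* The level is the entry at position [j], reached by the first [j.+1] entries. *)
have [|k /(mem_take) |k|t' [ut' st' tz]] := wz (take j.+1 s') (nth 0%N s' j).
- exact: take_uniq.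
- by rewrite (perm_mem ps).
- move=> /(nthP 0%N)[i]; rewrite size_takel // => ij <-; rewrite nth_take //.
  have := @sorted_leq_nth _ _ (@decreasing_on_trans _ w)
    (fun k => lexx `|w k|) 0%N _ ss i j.
  by rewrite !inE (leq_trans ij) // js; apply.
rewrite size_takel // in st'; rewrite -st'.
exact: level_h_l.
Qed.

Lemma projection_le (z : V) (s : seq nat) N : uniq s -> (size s <= N)%N ->
  `|\sum_(k <- s) a k z *: e k| <=
    8 * K ^+ 3 * `|z| * \sum_(1 <= k < N.+1) mu e k / k%:R.
Proof.
move=> us sN; apply: rearrangement_sum_le => // t i ut _ ti.
by exists t.
Qed.

Lemma dominated_sum_le (x z : V) (s t : seq nat) N : uniq s -> uniq t ->
  (size s <= size t)%N -> (size s <= N)%N ->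
  (forall i j, i \in s -> j \in t -> `|a i x| <= `|a j z|) ->
  `|\sum_(k <- s) a k x *: e k| <=
    8 * K ^+ 3 * `|z| * \sum_(1 <= k < N.+1) mu e k / k%:R.
Proof.
move=> us ut st sN xz.
apply: (@rearrangement_sum_le z s (fun k => a k x)) => // t0 i ut0 t0s it0.
have t0t : (size t0 <= size t)%N by rewrite (leq_trans _ st) // uniq_leq_size.
exists (take (size t0) t); split; [exact: take_uniq|exact: size_takel|].
(* The level [|w i|] is compared with [z] through an element of [t0], so the empty [t0] is treated
   apart. *)
case: t0 {ut0 t0t} t0s it0 => [|k0 t0] t0s it0 k; first by rewrite take0.
move=> /mem_take kt; apply: le_trans (it0 k0 (mem_head _ _)) _.
by apply: xz => //; apply: t0s; rewrite mem_head.
Qed.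

(** * Comparison with an arbitrary [N]-term approximant *)

Lemma greedy_ordering_le (x : V) pi : greedy_ordering a x pi ->
  forall k l, (k <= l)%N -> `|a (pi l) x| <= `|a (pi k) x|.
Proof.
move=> [_ xpi] k l.
apply: (@homo_leq _ (fun k => `|a (pi k) x|) (fun r r' => r' <= r)) => //.
by move=> r r' r'' h1 h2; apply: le_trans h1.
Qed.

(** Each of the three projections contributes [8 * K ^+ 3], and [z] itself contributes 1. *)
Lemma greedy_error_le (x y : V) pi N : greedy_ordering a x pi ->
  SigmaN a N y -> (0 < N)%N ->
  `|x - greedy_approx e a pi N x| <= (1 + 24 * K ^+ 3) *
    (\sum_(1 <= k < N.+1) mu e k / k%:R) * `|x - y|.
Proof.
move=> gx [G [GN y0]] N0; set S := \sum_(1 <= k < _) _; set z := x - y.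
have [pi' pK piK] := gx.1.
pose Gamma := [seq pi k | k <- iota 0 N].
have sGamma : size Gamma = N by rewrite size_map size_iota.
have uGamma : uniq Gamma by rewrite map_inj_uniq ?iota_uniq //; apply: can_inj pK.
have -> : greedy_approx e a pi N x = \sum_(k <- Gamma) a k x *: e k.
  rewrite big_map /greedy_approx.
  by rewrite -(big_mkord xpredT (fun k => a (pi k) x *: e (pi k))) /index_iota subn0.
pose A := [seq k <- G | k \notin Gamma]; pose B := [seq k <- Gamma | k \notin G].
have uA : uniq A by rewrite filter_uniq ?fset_uniq.
have uB : uniq B by rewrite filter_uniq.
(* [G] has at most as many elements as [Gamma]; removing the common part keeps the inequality. *)
have AB : (size A <= size B)%N.
  have GE : size [seq k <- G | k \in Gamma] = size [seq k <- Gamma | k \in G].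
    apply: perm_size; apply: uniq_perm; rewrite ?filter_uniq ?fset_uniq //.
    by move=> k; rewrite !mem_filter andbC.
  move: GN; rewrite -{1}sGamma.
  rewrite -(count_predC (mem Gamma) G) -(count_predC (mem G) Gamma) -!size_filter.
  by rewrite GE leq_add2l.
have AN : (size A <= N)%N.
  by apply: leq_trans AB _; rewrite size_filter -sGamma count_size.
have uGA : uniq (Gamma ++ A).
  rewrite cat_uniq uGamma uA andbT /=.
  by apply/hasPn => k; rewrite mem_filter => /andP[].
have yE : y = \sum_(k <- Gamma ++ A) a k y *: e k.
  apply: finite_support_sum => // k; rewrite mem_cat mem_filter negb_or.
  by move=> /andP[kG]; rewrite kG /=; apply: y0.
have xzE : x - \sum_(k <- Gamma) a k x *: e k =
    z - \sum_(k <- Gamma) a k z *: e k - \sum_(k <- A) a k z *: e k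
    + \sum_(k <- A) a k x *: e k.
  have zE s : \sum_(k <- s) a k z *: e k =
      \sum_(k <- s) a k x *: e k - \sum_(k <- s) a k y *: e k.
    by rewrite -sumrB; apply: eq_bigr => k _; rewrite coefB scalerBl.
  rewrite !zE /z {1}yE big_cat /=.
  set g := \sum_(k <- Gamma) a k x *: e k; set h := \sum_(k <- A) a k x *: e k.
  set g' := \sum_(k <- Gamma) _; set h' := \sum_(k <- A) _.
  by rewrite !opprB -[RHS]addrA subrK addrAC opprD !addrA !subrK.
(* On [B] the coefficients of [y] vanish, so those of [z] are those of [x]; indices of [B] precede
   those of [A] in the greedy ordering. *)
have domA : `|\sum_(k <- A) a k x *: e k| <= 8 * K ^+ 3 * `|z| * S.
  apply: (@dominated_sum_le _ _ _ B) => // i j.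
  rewrite !mem_filter => /andP[iG _] /andP[jG /mapP[l]].
  rewrite mem_iota add0n => /= lN jl.
  rewrite [a j z]coefB (y0 j) // subr0 jl -(piK i).
  apply: greedy_ordering_le => //; apply: leq_trans (ltnW lN) _.
  rewrite leqNgt; apply: contra iG => iN; apply/mapP; exists (pi' i) => //.
  by rewrite mem_iota.
have projG := projection_le z uGamma (eq_leq sGamma).
have projA := projection_le z uA AN.
rewrite xzE; apply: le_trans (ler_normD _ _) _.
have h1 := ler_normB (z - \sum_(k <- Gamma) a k z *: e k) (\sum_(k <- A) a k z *: e k).
have h2 := ler_normB z (\sum_(k <- Gamma) a k z *: e k).
have zS : `|z| <= S * `|z| by apply: ler_peMl => //; apply: sum_mu_ge1.
rewrite -/S in projG projA.
have -> : (1 + 24 * K ^+ 3) * S * `|z| =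
  S * `|z| + 8 * K ^+ 3 * `|z| * S + 8 * K ^+ 3 * `|z| * S + 8 * K ^+ 3 * `|z| * S.
  by ring.
lra.
Qed.

End QuasiGreedyBasis.

Theorem theorem1 (R : realType) (V : completeNormedModType R)
  (e : nat -> V) (a : nat -> V -> R) (K : R) :
  is_schauder_basis e a -> seminormalized e -> quasi_greedy e a ->
  is_qg_constant e a K ->
  exists C : R, 0 < C /\
    forall (N : nat) (x : V) (pi : nat -> nat), (0 < N)%N ->
      greedy_ordering a x pi ->
      `|x - greedy_approx e a pi N x| <=
        C * (8 * K ^+ 5) * (\sum_(1 <= k < N.+1) mu e k / k%:R) * sigmaN a N x.
Proof.
move=> basis_e e_sn _ [qgK _].
have K0 : 0 < K by apply: lt_le_trans (qg_bound_ge1 basis_e e_sn qgK).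
have D0 : 0 < 1 + 24 * K ^+ 3 by rewrite ltr_wpDr // mulr_ge0 // exprn_ge0 // ltW.
have E0 : 0 < 8 * K ^+ 5 by rewrite mulr_gt0 // exprn_gt0.
(* Chosen so that [C * (8 * K ^+ 5)] is the constant of [greedy_error_le]; since [1 <= K], it is at
   most 25/8. *)
exists ((1 + 24 * K ^+ 3) / (8 * K ^+ 5)); split; first exact: divr_gt0.
move=> N x pi N0 gx; rewrite divfK ?gt_eqF //.
set S := \sum_(1 <= k < _) _.
have S0 : 0 < S by apply: lt_le_trans (sum_mu_ge1 basis_e e_sn qgK N0).
rewrite -ler_pdivrMl ?mulr_gt0 //; apply: lb_le_inf.
  (* The approximant 0 shows that the infimum is over a nonempty set. *)
  exists `|x - 0|, 0; split=> //; exists fset0; split=> // k _.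
  by rewrite -[0](subrr (0 : V)) (coefB basis_e) subrr.
move=> _ [y [yN ->]]; rewrite ler_pdivrMl ?mulr_gt0 //.
exact: (greedy_error_le basis_e e_sn qgK gx yN N0).
Qed.
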